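(* Let $x=(x_1,\dots,x_n)\in\mathbb R^n$, let $d$ be an integer, and let $A$ be any subset of $B(x,d)\cap\{0,1\}^n$. Then there is $y\in\{0,1\}^n$ such that $|A\cap B(y,d)|\ge|A|/2$.
   Context: For $z\in\mathbb R^n$ and real $d$, $B(z,d)=\{w\in\mathbb R^n:\|w-z\|_1\le d\}$ is the (closed) $\ell_1$-ball of radius $d$ centered at $z$. *)

(* Defs.v *)
From HB Require Import structures.
From mathcomp Require Import all_boot all_order all_algebra finmap.
From mathcomp Require Import boolp classical_sets functions cardinality reals.

Set Implicit Arguments.
Unset Strict Implicit.
Unset Printing Implicit Defensive.

Import Order.TTheory GRing.Theory Num.Theory.

Local Open Scope classical_set_scope.
Local Open Scope ring_scope.

(* The norm `|_| that MathComp-Analysis puts on 'rV[R]_n is the sup norm. *)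
Definition l1norm (R : realType) (n : nat) (z : 'rV[R]_n) : R :=
  \sum_(i < n) `|z 0 i|.

Definition l1ball (R : realType) (n : nat) (z : 'rV[R]_n) (d : R) :
    set 'rV[R]_n :=
  [set w | l1norm (w - z) <= d].

Definition cube (R : realType) (n : nat) : set 'rV[R]_n :=
  [set w | forall i, w 0 i = 0 \/ w 0 i = 1].
Arguments cube R n : clear implicits.

(* fset_set is a junk value on infinite sets; by this lemma it is the honest
   finite set of elements for every subset of the cube. *)
Lemma finite_cube (R : realType) (n : nat) : finite_set (cube R n).
Proof.
pose f (b : 'rV[bool]_n) : 'rV[R]_n := map_mx (fun c : bool => c%:R) b.
apply: (sub_finite_set (B := f @` setT)); last first.
  by apply: finite_image; exact: finite_finset.
move=> w hw; exists (map_mx (fun c : R => c == 1) w) => //.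
apply/rowP => i; rewrite !mxE.
by case: (hw i) => ->; rewrite ?eqxx // eq_sym oner_eq0.
Qed.

(* Main.v *)
Require Import Defs.
From mathcomp Require Import all_boot all_order all_algebra finmap.
From mathcomp Require Import boolp classical_sets functions cardinality reals.
From mathcomp Require Import topology normedtype derive realfun exp.
From mathcomp Require Import zify ring lra.

Import Order.TTheory GRing.Theory Num.Theory.
Import numFieldNormedType.Exports.

Local Open Scope classical_set_scope.
Local Open Scope ring_scope.

(* Clip x to [0,1]^n and round it to a random vertex y, the coordinates being
   independent with means x_j.  For a in the cube the distance from a to y is
   then a sum S of independent Bernoulli variables with mean at most d, so by
   the theorem of Jogdeo and Samuels P(S <= d) >= 1/2, d being an integer; hence
   A meets B(y,d) in at least |A|/2 points on average.

   The median bound is obtained by smoothing.  With p_i + p_j fixed, P(S <= d)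
   is affine in p_i p_j: according to the sign of the slope, either the product
   is made minimal, so that p_i or p_j becomes 0 or 1 and disappears, or one of
   them is made equal to the mean of all p_i.  After finitely many steps S is
   binomial.  There, as a function of the failure probability s, P(S <= d) has
   derivative c (1-s)^d s^(n-1-d), and one compares s with its reflection q^2/s
   about the actual value q: s |-> C(s) + C(q^2/s) is nonincreasing on [q,1],
   hence 2 C(q) >= C(1) + C(q^2) >= 1. *)

(** * Distribution functions of sums of independent Bernoulli variables *)

(* [poisson_binomial_lt s K] is the probability that fewer than [K] of
   independent events with probabilities [s] occur. *)
Fixpoint poisson_binomial_lt {A : comNzRingType} (s : seq A) (K : nat) : A :=
  if s is p :: s' then
    (1 - p) * poisson_binomial_lt s' K + p * poisson_binomial_lt s' K.-1
  else (0 < K)%N%:R.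

Lemma poisson_binomial_lt_swap (A : comNzRingType) (x y : A) s K :
  poisson_binomial_lt (x :: y :: s) K = poisson_binomial_lt (y :: x :: s) K.
Proof. by rewrite /=; ring. Qed.

Lemma poisson_binomial_lt_rem (A : comNzRingType) (x : A) s K : x \in s ->
  poisson_binomial_lt s K = poisson_binomial_lt (x :: rem x s) K.
Proof.
elim: s K => // y s IHs K.
rewrite inE /= eq_sym; case: eqVneq => [->//|_ /= xs].
rewrite !(IHs _ xs); exact: poisson_binomial_lt_swap.
Qed.

Lemma poisson_binomial_lt0 (A : comNzRingType) (s : seq A) :
  poisson_binomial_lt s 0 = 0.
Proof. by elim: s => //= p s ->; rewrite !mulr0 addr0. Qed.

Lemma poisson_binomial_lt_rmorph (A B : comNzRingType) (f : {rmorphism A -> B})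
    s K :
  f (poisson_binomial_lt s K) = poisson_binomial_lt (map f s) K.
Proof.
elim: s K => [|p s IHs] K /=; first by rewrite rmorph_nat.
by rewrite rmorphD !rmorphM rmorphB rmorph1 !IHs.
Qed.

Lemma poisson_binomial_lt_ge0 (R : numDomainType) (s : seq R) K :
  all (fun p => 0 <= p <= 1) s -> 0 <= poisson_binomial_lt s K.
Proof.
elim: s K => [|p s IHs] K /=; first by rewrite ler0n.
by case/andP=> /andP[p0 p1] /IHs ge0; rewrite addr_ge0// mulr_ge0// subr_ge0.
Qed.

Lemma poisson_binomial_lt_size (A : comNzRingType) (s : seq A) K :
  (size s < K)%N -> poisson_binomial_lt s K = 1.
Proof.
elim: s K => [|p s IHs] [|K]//= sK.
by rewrite !IHs//; [ring | exact: ltnW].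
Qed.

Lemma poisson_binomial_lt_cons0 (A : comNzRingType) (s : seq A) K :
  poisson_binomial_lt (0 :: s) K = poisson_binomial_lt s K.
Proof. by rewrite /=; ring. Qed.

Lemma poisson_binomial_lt_cons1 (A : comNzRingType) (s : seq A) K :
  poisson_binomial_lt (1 :: s) K = poisson_binomial_lt s K.-1.
Proof. by rewrite /=; ring. Qed.

Lemma poisson_binomial_lt_nseq0 (A : comNzRingType) n K :
  poisson_binomial_lt (nseq n (0 : A)) K.+1 = 1.
Proof. by elim: n => //= n ->; ring. Qed.

(** * Binomial case: density and derivative *)

(** Pascal's rule drives the induction. The ring is general because the derivative below takes the
    indeterminate ['X] for [x]. *)
Lemma binomial_ltB (A : comNzRingType) (x : A) n k :
  poisson_binomial_lt (nseq n (1 - x)) k.+1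
    - poisson_binomial_lt (nseq n (1 - x)) k
  = 'C(n, k)%:R * ((1 - x) ^+ k * x ^+ (n - k)).
Proof.
elim: n k => [|n IHn] k.
  by case: k => [|k] /=; rewrite ?bin0 ?bin0n /=; ring.
case: k => [|k]; rewrite [LHS]/=.
  have := IHn 0%N; rewrite poisson_binomial_lt0 !bin0 !subn0 subr0 => ->.
  by rewrite exprS; ring.
rewrite binS natrD [RHS]mulrDl.
have -> : 'C(n, k)%:R * ((1 - x) ^+ k.+1 * x ^+ (n.+1 - k.+1)) =
   (1 - x) * ('C(n, k)%:R * ((1 - x) ^+ k * x ^+ (n - k))) :> A.
  by rewrite subSS exprS; ring.
have -> : 'C(n, k.+1)%:R * ((1 - x) ^+ k.+1 * x ^+ (n.+1 - k.+1)) =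
   x * ('C(n, k.+1)%:R * ((1 - x) ^+ k.+1 * x ^+ (n - k.+1))) :> A.
  have [kn|nk] := ltnP k n; last by rewrite bin_small//; ring.
  by rewrite subSS -[(n - k)%N]subnSK// !exprS; ring.
by rewrite -!IHn; ring.
Qed.

(** Differentiating the recursion leaves, besides two inductive derivatives, a difference of
    consecutive values, which [binomial_ltB] evaluates. *)
Lemma deriv_binomial_lt (R : comNzRingType) n k :
  (poisson_binomial_lt (nseq n (1 - 'X : {poly R})) k.+1)^`() =
  (n * 'C(n.-1, k))%:R * ((1 - 'X) ^+ k * 'X ^+ (n.-1 - k)).
Proof.
elim: n k => [|n IHn] k /=; first by rewrite mul0n mul0r derivC.
rewrite !(derivD, derivM, derivB, derivN, derivX, derivC) !IHn.
set P := poisson_binomial_lt _.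
have dP : (P k)^`() = if k is j.+1 then
    (n * 'C(n.-1, j))%:R * ((1 - 'X) ^+ j * 'X ^+ (n.-1 - j)) else 0.
  by case: k => [|j]; rewrite ?IHn // /P poisson_binomial_lt0 derivC.
have := @binomial_ltB {poly R} 'X n k; rewrite -/P => /(canRL (subrK _)) PE.
rewrite {}PE dP.
case: n IHn P dP => [|n] _ P dP.
  by case: k {dP} => [|k]; rewrite ?bin0n ?mul0n ?muln0 /=; ring.
case: k dP => [|k] dP; rewrite /= ?bin0 ?subn0 ?muln1.
  by rewrite exprS -!natr1; ring.
(* The first summand comes from the difference, the other two from the inductive derivatives. *)
have -> : (n.+2 * 'C(n.+1, k.+1) =
  'C(n.+1, k.+1) + n.+1 * 'C(n, k.+1) + n.+1 * 'C(n, k))%N.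
  by rewrite binS; ring.
rewrite subSS [(_ * _)%N]mulnC.
have [kn|nk] := ltnP k n; last by rewrite [in 'C(n, k.+1)]bin_small// !exprS; ring.
by rewrite -[(n - k)%N]subnSK// !exprS; ring.
Qed.

(** * Median of the binomial distribution by reflection *)

Lemma is_derive_le0_le (R : realType) (f df : R -> R) (a b : R) : a <= b ->
  (forall x, a <= x <= b -> is_derive x 1 f (df x)) ->
  (forall x, a <= x <= b -> df x <= 0) -> f b <= f a.
Proof.
move=> ab fdf df0.
have oo x : x \in `]a, b[ -> a <= x <= b.
  by rewrite in_itv /= => /andP[/ltW -> /ltW ->].
apply: (@ler0_derive1_le_cc _ f a b) => //.
- by move=> x /oo /fdf H; exact: ex_derive.
- by move=> x /oo xab; have H := fdf _ xab; rewrite derive1E derive_val df0.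
- apply: derivable_within_continuous => x; rewrite in_itv /= => /fdf H.
  exact: ex_derive.
- by rewrite in_itv /= lexx ab.
- by rewrite in_itv /= lexx ab.
Qed.

(* The logarithm of the quotient of the two sides has a nonpositive derivative
   in [s], because (1 - s)(s - q^2) <= (1 - q)^2 s, i.e. (s - q)^2 >= 0; both
   sides agree at [s = q]. *)
Lemma reflected_density_le (R : realType) (q s : R) (k l : nat) :
  0 < q < 1 -> (1 - q) * (k + l)%:R <= k%:R -> q <= s <= 1 ->
  (1 - s) ^+ k * s ^+ (k + l.*2) <= (s - q ^+ 2) ^+ k * q ^+ l.*2.
Proof.
move=> /andP[q0 q1] pk /andP[qs s1].
have pos (x : R) : q <= x -> [/\ 0 < x & 0 < x - q ^+ 2].
  by move=> qx; split; nra.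
have [k0|k0] := posnP k.
  have -> : l = 0%N.
    apply/eqP; rewrite -leqn0 -(ler_nat R).
    by move: pk; rewrite k0 add0n; nra.
  by rewrite k0 double0 addn0 !expr0.
(* Logarithms require [1 - s > 0]; at [s = 1] the left side vanishes since [k > 0]. *)
have [->|sN1] := eqVneq s 1.
  rewrite subrr expr0n eqn0Ngt k0 mul0r mulr_ge0// exprn_ge0//; last exact: ltW.
  by nra.
have {sN1} s1 : s < 1 by rewrite lt_neqAle sN1.
pose L x := k%:R * ln (1 - x) + (k + l.*2)%:R * ln x - k%:R * ln (x - q ^+ 2) : R.
pose dL x := - (k%:R / (1 - x)) + (k + l.*2)%:R / x - k%:R / (x - q ^+ 2) : R.
have Ldecr : L s <= L q.
  apply: (@is_derive_le0_le _ L dL) => // x /andP[qx xs].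
    have [x0 xq0] := pos _ qx.
    have x1 : 0 < 1 - x by lra.
    have d1 : is_derive x 1 (@ln R \o (fun y => 1 - y)) ((1 - x)^-1 * (0 - 1)).
      by apply: is_derive1_comp; exact: is_derive1_ln.
    have d2 := is_derive1_ln x0.
    have d3 : is_derive x 1 (@ln R \o (fun y => y - q ^+ 2))
        ((x - q ^+ 2)^-1 * (1 - 0)).
      by apply: is_derive1_comp; exact: is_derive1_ln.
    have dd := is_deriveB (is_deriveD (is_deriveZ k%:R d1)
      (is_deriveZ (k + l.*2)%:R d2)) (is_deriveZ k%:R d3).
    apply: (is_derive_eq dd).
    rewrite /dL /GRing.scale /=; ring.
  have [x0 xq0] := pos _ qx.
  have x1 : 0 < 1 - x by lra.
  have -> : dL x = ((k + l.*2)%:R * ((1 - x) * (x - q ^+ 2))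
      - k%:R * x * (1 - q ^+ 2)) / (x * (1 - x) * (x - q ^+ 2)).
    by rewrite /dL; field; rewrite ?gt_eqF// subr_gt0.
  rewrite pmulr_lle0 ?invr_gt0 ?mulr_gt0// subr_le0.
  have H1 : (1 - x) * (x - q ^+ 2) <= (1 - q) ^+ 2 * x by nra.
  apply: (le_trans (ler_wpM2l (ler0n _ _) H1)).
  (* Twice [pk] minus [k (1 - q)]. *)
  have : (k + l.*2)%:R * (1 - q) <= k%:R * (1 + q).
    by move: pk; rewrite -addnn !natrD; lra.
  have : 0 <= (1 - q) * x by nra.
  by move=> /ler_wpM2l H /H; lra.
have [s0 sq0] := pos _ qs.
have [_ qq0] := pos _ (lexx q).
have s10 : 0 < 1 - s by lra.
have q10 : 0 < 1 - q by lra.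
rewrite -ler_ln ?posrE ?mulr_gt0 ?exprn_gt0//.
rewrite !lnM ?posrE ?exprn_gt0// !lnXn//.
move: Ldecr; rewrite /L.
have -> : q - q ^+ 2 = (1 - q) * q by ring.
rewrite lnM ?posrE// -!(mulr_natl (ln _)) -!addnn !natrD; lra.
Qed.

Lemma binomial_median (R : realType) (p : R) (n k : nat) :
  0 <= p <= 1 -> n%:R * p <= k%:R ->
  2^-1 <= poisson_binomial_lt (nseq n p) k.+1.
Proof.
move=> /andP[p0 p1] npk.
have half1 : 2^-1 <= 1 :> R by lra.
have [nk|kn] := leqP n k.
  by rewrite poisson_binomial_lt_size// size_nseq ltnS.
move: p0; rewrite le_eqVlt => /predU1P[<-|p0].
  by rewrite poisson_binomial_lt_nseq0.
have {p1} p1 : p < 1.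
  rewrite lt_neqAle p1 andbT; apply: contraTneq npk => ->.
  by rewrite mulr1 ler_nat -ltnNge.
pose q := 1 - p.
pose C : {poly R} := poisson_binomial_lt (nseq n (1 - 'X)) k.+1.
have CE x : C.[x] = poisson_binomial_lt (nseq n (1 - x)) k.+1.
  rewrite /C -[_.[x]]/(horner_eval x _) poisson_binomial_lt_rmorph map_nseq.
  by rewrite /= /horner_eval !hornerE.
pose m := (n.-1 - k)%N.
have nE : n = (k + m.+1)%N by rewrite /m; lia.
pose c : R := (n * 'C(n.-1, k))%:R.
have dC x : C^`().[x] = c * ((1 - x) ^+ k * x ^+ m).
  by rewrite deriv_binomial_lt -/m -polyC_natr !hornerE.
(* The reflection fixes [q] and sends [1] to [q ^+ 2], so [G q = 2 C(q)] and
   [G 1 = 1 + C(q ^+ 2)]. *)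
pose G x := C.[x] + C.[q ^+ 2 / x].
pose dG x := C^`().[x] - C^`().[q ^+ 2 / x] * (q ^+ 2 / x ^+ 2).
have q0 : 0 < q by rewrite /q; lra.
have : G 1 <= G q.
  apply: (@is_derive_le0_le _ G dG); first by rewrite /q; lra.
    move=> x /andP[qx x1]; have x0 : x != 0 by rewrite gt_eqF; lra.
    have dV : is_derive x 1 (fun y => q ^+ 2 / y) (q ^+ 2 *: (- x ^- 2 *: 1)).
      exact: (is_deriveZ _ (is_deriveV x0 (is_derive_id x 1))).
    have dC2 := @is_derive1_comp _ (horner C) (fun y => q ^+ 2 / y) x _ _
      (is_derive_poly C (q ^+ 2 / x)) dV.
    apply: (is_derive_eq (is_deriveD (is_derive_poly C x) dC2)); rewrite /dG /GRing.scale /=; ring.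
  move=> x /andP[qx x1]; have x0 : 0 < x by lra.
  rewrite /dG !dC -mulrA -mulrBr mulr_ge0_le0// subr_le0.
  (* This is [dG x <= 0] without the factor [c], multiplied by [x ^+ (k + m.+2)]. *)
  have le_dens : (1 - x) ^+ k * x ^+ (k + m.+1.*2) <=
      (x - q ^+ 2) ^+ k * q ^+ m.+1.*2.
    apply: reflected_density_le; rewrite ?qx ?q0//=; first by rewrite /q; lra.
    by rewrite -nE /q opprB addrCA subrr addr0 mulrC.
  have -> : (1 - q ^+ 2 / x) ^+ k * (q ^+ 2 / x) ^+ m * (q ^+ 2 / x ^+ 2) =
      (x - q ^+ 2) ^+ k * q ^+ m.+1.*2 / x ^+ (k + m.+2).
    have -> : 1 - q ^+ 2 / x = (x - q ^+ 2) / x by field; rewrite gt_eqF.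
    rewrite -mul2n exprM; move: (q ^+ 2) => r.
    rewrite !exprMn !exprVn exprD !exprS. field.
    by rewrite ?expf_neq0// gt_eqF.
  rewrite ler_pdivlMr ?exprn_gt0//; apply: le_trans le_dens.
  have -> : (k + m.+1.*2 = m + (k + m.+2))%N by lia.
  by rewrite -mulrA -exprD.
rewrite /G !CE divr1 expr2 mulfK ?gt_eqF// -expr2 subrr poisson_binomial_lt_nseq0.
rewrite /q opprB addrCA subrr addr0 -/q.
have : 0 <= poisson_binomial_lt (nseq n (1 - q ^+ 2)) k.+1.
  apply: poisson_binomial_lt_ge0; apply/allP => y /nseqP[-> _].
  by rewrite /q; nra.
lra.
Qed.

(** * Smoothing to the binomial case *)

Lemma perm_poisson_binomial_lt (A : comNzRingType) (s t : seq A) K :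
  perm_eq s t -> poisson_binomial_lt s K = poisson_binomial_lt t K.
Proof.
elim: s t K => [|x s IHs] t K; first by rewrite perm_sym => /perm_nilP ->.
move=> st.
have xt : x \in t by rewrite -(perm_mem st) mem_head.
rewrite (@poisson_binomial_lt_rem _ x t)// /=.
have sr : perm_eq s (rem x t).
  by rewrite -(perm_cons x); apply: perm_trans st _; exact: perm_to_rem.
by rewrite !(IHs _ _ sr).
Qed.

(** Otherwise the deviations [p - a] are nonnegative with sum zero, hence all zero. *)
Lemma has_lt_mean (R : realDomainType) (s : seq R) (a : R) :
  \sum_(p <- s) p = a *+ size s -> ~~ all (pred1 a) s -> has (< a) s.
Proof.
move=> sumE; apply: contraR => /hasPn ge_a.
have : \sum_(p <- s) (p - a) == 0.
  by rewrite sumrB sumE big_const_seq count_predT iter_addr_0 subrr.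
rewrite big_seq psumr_eq0; last first.
  by move=> p /ge_a; rewrite subr_ge0 -leNgt.
move=> /allP eq0; apply/allP => p ps /=.
by have := eq0 _ ps; rewrite ps subr_eq0.
Qed.

Lemma has_gt_mean (R : realDomainType) (s : seq R) (a : R) :
  \sum_(p <- s) p = a *+ size s -> ~~ all (pred1 a) s -> has (> a) s.
Proof.
move=> sumE alls; have := @has_lt_mean R (map -%R s) (- a).
rewrite big_map sumrN sumE size_map mulNrn all_map has_map => /(_ erefl) H.
have {}/H : ~~ all (preim -%R (pred1 (- a))) s.
  by apply: contra alls => /allP H'; apply/allP => p /H' /=; rewrite eqr_opp.
by case/hasP => p ps /=; rewrite ltrN2 => ?; apply/hasP; exists p.
Qed.

(** Isolates the dependence on [x * y] at fixed [x + y]; the slope is a second difference in [K]. *)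
Lemma poisson_binomial_lt_cons2 (A : comNzRingType) (x y : A) s K :
  poisson_binomial_lt (x :: y :: s) K =
  poisson_binomial_lt s K
  - (x + y) * (poisson_binomial_lt s K - poisson_binomial_lt s K.-1)
  + x * y * (poisson_binomial_lt s K - 2 * poisson_binomial_lt s K.-1
             + poisson_binomial_lt s K.-2).
Proof. by rewrite /=; ring. Qed.

(** The Jogdeo-Samuels bound, by induction on the number of variables and then on the number of
    entries different from their mean. *)
Lemma poisson_binomial_median (R : realType) (s : seq R) (k : nat) :
  all (fun p => 0 <= p <= 1) s -> \sum_(p <- s) p <= k%:R ->
  2^-1 <= poisson_binomial_lt s k.+1.
Proof.
move: {2}(size s) (erefl (size s)) => n.
elim: n s k => [|n IHn] s k.
  by move/size0nil => ->; move=> _ _ /=; lra.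
move=> size_s all_s sum_s.
pose a : R := (\sum_(p <- s) p) / n.+1%:R.
have sumE : \sum_(p <- s) p = a *+ n.+1.
  by rewrite -mulr_natr /a divfK// pnatr_eq0.
have ak : n.+1%:R * a <= k%:R by rewrite mulr_natl -sumE.
have {sum_s} := ltnSn (count (predC1 a) s).
move: {2}(count (predC1 a) s).+1 => c.
(* Smoothing keeps the sum, so [a] remains the mean throughout the inner induction. *)
clearbody a.
elim: c s size_s all_s sumE => // c IHc s size_s all_s sumE countc.
have [all_a|not_a] := boolP (all (pred1 a) s).
  have sE : s = nseq n.+1 a by rewrite -size_s; apply/all_pred1P.
  rewrite sE; apply: binomial_median => //.
  by move: all_s; rewrite sE /= => /andP[].
have hl : has (< a) s by apply: has_lt_mean; rewrite ?size_s.
have hg : has (> a) s by apply: has_gt_mean; rewrite ?size_s.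
case/hasP: hl => x xs /= xa; case/hasP: hg => y ys /= ay.
have yx : y != x by rewrite gt_eqF// (lt_trans xa).
have yrx : y \in rem x s by exact: rem_mem.
pose t := rem y (rem x s).
have st : perm_eq s (x :: y :: t).
  by rewrite (perm_trans (perm_to_rem xs))// perm_cons perm_to_rem.
move: all_s; rewrite (perm_all _ st) /= => /and3P[/andP[x0 x1] /andP[y0 y1] all_t].
move: size_s; rewrite (perm_size st) /= => -[size_t].
move: (sumE); rewrite (perm_big _ st) /= !big_cons => sum_t.
move: countc; rewrite (permP st) /= (lt_eqF xa) (gt_eqF ay) /= !add1n ltnS => countc.
rewrite (@perm_poisson_binomial_lt _ _ _ _ st).
have t0 : 0 <= \sum_(p <- t) p.
  by rewrite big_seq sumr_ge0// => p /(allP all_t) /andP[].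
move: ak; rewrite mulr_natl -sum_t => ak.
have [c0|c0] := leP 0 (poisson_binomial_lt t k.+1 - 2 * poisson_binomial_lt t k
             + poisson_binomial_lt t k.-1).
  (* Nonnegative slope: the product is least at [0, x + y] or at [1, x + y - 1], whichever pair lies
     in [[0,1]]; the entry [0] or [1] then drops out. *)
  have [xy1|xy1] := leP (x + y) 1.
    apply: (@le_trans _ _ (poisson_binomial_lt (0 :: x + y :: t) k.+1)).
      rewrite poisson_binomial_lt_cons0; apply: IHn => //=.
        by rewrite xy1 addr_ge0.
      by rewrite big_cons -addrA.
    by rewrite !poisson_binomial_lt_cons2 /= mul0r mul0r add0r lerD2l mulr_ge0// mulr_ge0.
  case: k c0 ak {IHc} => [|k] c0 ak; first by exfalso; lra.
  apply: (@le_trans _ _ (poisson_binomial_lt (1 :: x + y - 1 :: t) k.+2)).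
    rewrite poisson_binomial_lt_cons1; apply: IHn => //=.
      by apply/andP; split=> //; apply/andP; split; lra.
    by move: ak; rewrite big_cons -natr1; lra.
  rewrite !poisson_binomial_lt_cons2 [1 + _]addrC subrK lerD2l mul1r ler_wpM2r//.
  by nra.
(* Negative slope: the product grows by [(a - x) (y - a) > 0], and fewer entries differ from [a]. *)
apply: (@le_trans _ _ (poisson_binomial_lt (a :: x + y - a :: t) k.+1)).
  apply: IHc => /=.
  - by rewrite size_t.
  - by apply/and3P; split=> //; apply/andP; split; lra.
  - by rewrite !big_cons -sum_t; ring.
  - by rewrite eqxx /= add0n; apply: leq_ltn_trans countc; rewrite -add1n leq_add2r leq_b1.
rewrite !poisson_binomial_lt_cons2 [a + _]addrC subrK lerD2l.
by rewrite ler_wnM2r ?ltW//; nra.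
Qed.

(** * Rounding by conditional expectations *)

(* Derandomization: the bit at [h] is drawn with mean [x h]; conditioning on it
   turns the budget [K i] into its predecessor exactly when it differs from
   [a i h], and one of the two values does at least as well as the average. *)
Lemma exists_rounding (R : realDomainType) (I : Type) (J : eqType) (r : seq I)
    (x : J -> R) (a : I -> J -> bool) (l : seq J) (K : I -> nat) :
  (forall j, 0 <= x j <= 1) -> uniq l ->
  exists y : J -> bool,
    \sum_(i <- r) poisson_binomial_lt
      [seq if a i j then 1 - x j else x j | j <- l] (K i) <=
    \sum_(i <- r) (count (fun j => y j != a i j) l < K i)%N%:R.
Proof.
move=> x01; elim: l K => [|h l IHl] K; first by exists (fun=> false).
case/andP=> hl /IHl {}IHl.
(* Truncation at [K i = 0] is harmless: no count is below [0]. *)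
pose K' b i := if b != a i h then (K i).-1 else K i.
pose F b := \sum_(i <- r) poisson_binomial_lt
  [seq if a i j then 1 - x j else x j | j <- l] (K' b i).
have [b Fb] : exists b, (1 - x h) * F false + x h * F true <= F b.
  have /andP[x0 x1] := x01 h.
  by have [|] := leP (F false) (F true); [exists true | exists false]; nra.
have [y Fy] := IHl (K' b).
exists (fun j => if j == h then b else y j).
have -> : \sum_(i <- r) poisson_binomial_lt
    [seq if a i j then 1 - x j else x j | j <- h :: l] (K i) =
    (1 - x h) * F false + x h * F true.
  rewrite /F !mulr_sumr -big_split; apply: eq_bigr => i _ /=.
  by rewrite /K'; case: (a i h) => /=; ring.
apply: (le_trans Fb); apply: (le_trans Fy).
rewrite le_eqVlt; apply/orP; left; apply/eqP; apply: eq_bigr => i _ /=.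
rewrite eqxx; congr (nat_of_bool _)%:R.
have -> : count (fun j => (if j == h then b else y j) != a i j) l =
    count (fun j => y j != a i j) l.
  by apply: eq_in_count => j jl; rewrite ifN//; apply: contraNneq hl => <-.
by rewrite /K'; case: (b != a i h) => //=; lia.
Qed.

(** * Distances to cube vertices and conclusion *)

Lemma l1norm_ge0 (R : realType) (n : nat) (z : 'rV[R]_n) : 0 <= l1norm z.
Proof. by apply: sumr_ge0 => i _; exact: normr_ge0. Qed.

(** Turns membership in a ball into the mismatch count of [exists_rounding]. *)
Lemma l1norm_cubeB (R : realType) (n : nat) (a : 'rV[R]_n) (y : 'I_n -> bool) :
  cube R n a ->
  l1norm (a - \row_j (y j)%:R) =
    (count (fun j => y j != (a 0 j == 1)) (enum 'I_n))%:R.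
Proof.
move=> ca; rewrite /l1norm -sum1_count natr_sum [RHS]big_mkcond [RHS]big_enum /=.
apply: eq_bigr => j _; rewrite !mxE.
by case: (ca j) => ->; rewrite ?eqxx ?[0 == 1]eq_sym ?oner_eq0;
  case: (y j); rewrite /= ?subrr ?subr0 ?sub0r ?normrN ?normr0 ?normr1.
Qed.

(** The left side is [|a - c|], the probability that a bit of mean [c] differs from [a]; clipping to
    [[0,1]] never increases the distance to a point of [[0,1]]. *)
Lemma clip_cube_le (R : realDomainType) (x a : R)
    (c := Num.min 1 (Num.max 0 x)) : a = 0 \/ a = 1 ->
  (if a == 1 then 1 - c else c) <= `|a - x|.
Proof.
move=> ha; have := ler_norm (a - x); have := ler_norm (x - a).
rewrite distrC; have := normr_ge0 (a - x).
rewrite /c minEle maxEle; case: ha => ->; rewrite ?eqxx ?[0 == 1]eq_sym ?oner_eq0.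
  by case: (leP 0 x) => ?; case: ifP; lra.
by case: (leP 0 x) => ?; case: ifP; lra.
Qed.

Theorem theorem6p2 (R : realType) (n : nat) (x : 'rV[R]_n) (d : int)
    (A : set 'rV[R]_n) (hA : A `<=` l1ball x d%:~R `&` cube R n) :
  exists2 y : 'rV[R]_n, cube R n y &
    (#|` fset_set A|%fset)%:R / 2 <=
      (#|` fset_set (A `&` l1ball y d%:~R)|%fset)%:R :> R.
Proof.
have cubeA a : A a -> cube R n a by case/hA.
have finA : finite_set A := sub_finite_set cubeA (finite_cube R n).
(* A negative radius makes the ball, hence [A], empty, so any vertex serves. *)
case: d hA => [k|k] hA; last first.
  exists 0 => [i|]; first by left; rewrite mxE.
  suff -> : A = set0 by rewrite fset_set0 cardfs0 mul0r ler0n.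
  rewrite -subset0 => a /hA[] /(le_trans (l1norm_ge0 _ _ _)).
  by rewrite NegzE mulrNz oppr_ge0 -pmulrn lern0.
pose c j := Num.min 1 (Num.max 0 (x 0 j)).
have c01 j : 0 <= c j <= 1.
  by rewrite /c le_min ler01 le_max lexx ge_min lexx.
(* The strict budget [k.+1] encodes distance at most [k]. *)
have [y ydist] := @exists_rounding R _ _ (fset_set A) c
  (fun a j => a 0 j == 1) (enum 'I_n) (fun=> k.+1) c01 (enum_uniq _).
exists (\row_j (y j)%:R) => [i|].
  by rewrite mxE; case: (y i); [right | left].
set ball := l1ball _ _.
have -> : (#|` fset_set (A `&` ball)|%fset)%:R =
    \sum_(a <- fset_set A)
      (count (fun j => y j != (a 0 j == 1)%R) (enum 'I_n) < k.+1)%N%:R :> R.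
  rewrite -natr_sum; congr _%:R.
  have -> : #|` fset_set (A `&` ball)|%fset =
      size [seq a <- fset_set A | `[< ball a >]].
    apply/perm_size/uniq_perm; rewrite ?filter_uniq ?fset_uniq// => a.
    rewrite mem_filter !in_fset_set//; last exact: finite_setIl.
    by rewrite in_setI andbC.
  rewrite size_filter -sum1_count big_mkcond big_seq [RHS]big_seq.
  apply: eq_bigr => a; rewrite in_fset_set// inE => Aa.
  rewrite ltnS -(ler_nat R) -l1norm_cubeB; last exact: cubeA.
  have -> : `[< ball a >] = (l1norm (a - \row_j (y j)%:R) <= k%:R).
    by apply/asboolP/idP.
  by case: (_ <= _).
apply: le_trans ydist.
rewrite -sum1_size natr_sum mulr_suml !big_seq ler_sum// => a.
rewrite in_fset_set// inE => Aa; rewrite mul1r.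
apply: poisson_binomial_median.
  by apply/allP => _ /mapP[j _ ->]; have := c01 j; case: ifP; lra.
(* Summing [clip_cube_le] over coordinates bounds the mean distance by [l1norm (a - x)], which is at
   most [k]. *)
have [+ _] := hA _ Aa; apply: le_trans.
rewrite big_map big_enum; apply: ler_sum => j _; rewrite !mxE.
exact/clip_cube_le/cubeA.
Qed.
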